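(* Let $(M,g)$ be a semi-Riemannian manifold of dimension $m=n+2$ with Riemannian curvature tensor $R$. Assume that there are Killing vector fields $\xi_0,\xi_1,\dots,\xi_n$ that span $\xi_0^\perp$ and satisfy $$[\xi_0,\xi_i]=0,\qquad [\xi_i,\xi_j]\in\langle\xi_0\rangle\qquad\text{for all } i,j=1,\dots,n.$$ Then $\xi_0$ is parallel, and $R(X,Y)=0$ and $\nabla_XR=0$ for all $X,Y\in\xi_0^\perp$. In particular, if $(M,g)$ is Lorentzian, it is a plane wave.
   Context: Manifolds are assumed connected, and the metric $g$ may have arbitrary signature. $\nabla$ is the Levi-Civita connection of $g$, $\langle\xi_0\rangle$ denotes the span of $\xi_0$, and $\xi_0^\perp\subset TM$ its $g$-orthogonal complement. $R(X,Y)$ is regarded as an endomorphism of $TM$. A plane wave is a non-flat Lorentzian manifold $(M,g)$ that admits a vector field $\xi$ such that $\nabla\xi=0$, $g(\xi,\xi)=0$, and $R(X,Y)=0$ and $\nabla_XR=0$ for all $X,Y\in\xi^\perp$.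
   Formalization: The last sentence is proved for non-flat Lorentzian (M,g): plane waves are non-flat by definition, and Minkowski space with a null translation ξ_0 and spatial translations ξ_i satisfies all the hypotheses but is flat. *)

(* Defs.v *)
From HB Require Import structures.
From mathcomp Require Import all_boot all_order all_algebra.
From mathcomp Require Import all_classical all_reals all_analysis.

Set Implicit Arguments.
Unset Strict Implicit.
Unset Printing Implicit Defensive.
Import Order.TTheory GRing.Theory Num.Theory.
Import numFieldNormedType.Exports.
Local Open Scope classical_set_scope.
Local Open Scope ring_scope.

(* C^k on an open set V of a finite-dimensional space.  In finite dimension,
   continuity of x |-> 'd f x amounts to continuity of all the 'D_v f, whence
   the recursion on directional derivatives. *)
Fixpoint Cn_on (R : realType) (U W : normedModType R) (k : nat) (V : set U)
    (f : U -> W) : Prop :=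
  match k with
  | 0%N => forall x, V x -> {for x, continuous f}
  | k'.+1 => (forall x, V x -> differentiable f x) /\
             forall v : U, Cn_on k' V (fun x => 'D_v f x)
  end.

Definition smooth_on (R : realType) (U W : normedModType R) (V : set U)
    (f : U -> W) : Prop :=
  forall k, Cn_on k V f.

(* A connected smooth manifold, given by an atlas.  The chart [c] is the
   homeomorphism [phi c] from [dom c] onto [cod c], with inverse [psi c]; the
   values of [phi c] and [psi c] outside these sets are irrelevant. *)
Record manifold (R : realType) (m : nat) := Manifold {
  point_of :> topologicalType;
  manifold_hausdorff : hausdorff_space point_of;
  manifold_second_countable : @second_countable point_of;
  manifold_connected : connected [set: point_of];
  atlas : Type;
  dom : atlas -> set point_of;
  cod : atlas -> set 'rV[R]_m;
  phi : atlas -> point_of -> 'rV[R]_m;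
  psi : atlas -> 'rV[R]_m -> point_of;
  dom_open : forall c, open (dom c);
  cod_open : forall c, open (cod c);
  dom_cover : forall p, exists c, dom c p;
  phi_cod : forall c p, dom c p -> cod c (phi c p);
  psi_dom : forall c x, cod c x -> dom c (psi c x);
  phiK : forall c p, dom c p -> psi c (phi c p) = p;
  psiK : forall c x, cod c x -> phi c (psi c x) = x;
  phi_continuous : forall c p, dom c p -> {for p, continuous (phi c)};
  psi_continuous : forall c x, cod c x -> {for x, continuous (psi c)};
  transition_smooth : forall c c',
    smooth_on (cod c `&` psi c @^-1` dom c') (phi c' \o psi c)
}.

Section Geometry.
Context {R : realType} {m : nat} (M : manifold R m).

Definition overlap (c c' : atlas M) : set 'rV[R]_m :=
  cod c `&` psi c @^-1` dom c'.

Definition transition (c c' : atlas M) : 'rV[R]_m -> 'rV[R]_m :=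
  phi c' \o psi c.

(* Tensor fields and connections on M are families of local representatives,
   one on each [cod c], related by the usual transformation laws.  A tangent
   vector is represented in the chart c by the row of its components. *)

Record vfield := VField {
  vcomp :> atlas M -> 'rV[R]_m -> 'rV[R]_m;
  vcomp_smooth : forall c, smooth_on (cod c) (vcomp c);
  vcomp_transition : forall c c' x, overlap c c' x ->
    vcomp c' (transition c c' x) = 'D_(vcomp c x) (transition c c') x
}.

Definition form (G : 'M[R]_m) (u v : 'rV[R]_m) : R := (u *m G *m v^T) 0 0.

Record metric := Metric {
  gram : atlas M -> 'rV[R]_m -> 'M[R]_m;
  gram_smooth : forall c, smooth_on (cod c) (gram c);
  gram_sym : forall c x, cod c x -> (gram c x)^T = gram c x;
  gram_nondegenerate : forall c x, cod c x -> gram c x \in unitmx;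
  gram_transition : forall c c' x, overlap c c' x -> forall u v,
    form (gram c' (transition c c' x))
      ('D_u (transition c c') x) ('D_v (transition c c') x)
    = form (gram c x) u v
}.

(* [christoffel c x u v] is the vector with components
   \sum_(i, j) Gamma^k_ij(x) u_i v_j. *)
Record connection := Connection {
  christoffel : atlas M -> 'rV[R]_m -> 'rV[R]_m -> 'rV[R]_m -> 'rV[R]_m;
  christoffel_linearl : forall c x, cod c x -> forall v,
    linear (fun u => christoffel c x u v);
  christoffel_linearr : forall c x, cod c x -> forall u,
    linear (christoffel c x u);
  christoffel_smooth : forall c u v,
    smooth_on (cod c) (fun x => christoffel c x u v);
  christoffel_transition : forall c c' x, overlap c c' x -> forall u v,
    'D_(christoffel c x u v) (transition c c') x
    = 'D_u (fun y => 'D_v (transition c c') y) x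
      + christoffel c' (transition c c' x)
          ('D_u (transition c c') x) ('D_v (transition c c') x)
}.

(* X represents, in the chart c, a smooth vector field defined on the open
   subset [psi c @` V] of M. *)
Definition local_vfield (c : atlas M) (V : set 'rV[R]_m)
    (X : 'rV[R]_m -> 'rV[R]_m) : Prop :=
  [/\ open V, V `<=` cod c & smooth_on V X].

Definition bracket (X Y : 'rV[R]_m -> 'rV[R]_m) : 'rV[R]_m -> 'rV[R]_m :=
  fun x => 'D_(X x) Y x - 'D_(Y x) X x.

Definition gprod (g : metric) (c : atlas M) (X Y : 'rV[R]_m -> 'rV[R]_m) :
    'rV[R]_m -> R :=
  fun x => form (gram g c x) (X x) (Y x).

Definition nabla (D : connection) (c : atlas M) (X Y : 'rV[R]_m -> 'rV[R]_m) :
    'rV[R]_m -> 'rV[R]_m :=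
  fun x => 'D_(X x) Y x + christoffel D c x (X x) (Y x).

Definition riem (D : connection) (c : atlas M)
    (X Y Z : 'rV[R]_m -> 'rV[R]_m) : 'rV[R]_m -> 'rV[R]_m :=
  fun x => nabla D c X (nabla D c Y Z) x - nabla D c Y (nabla D c X Z) x
           - nabla D c (bracket X Y) Z x.

(* (nabla_X R)(Y, Z) W *)
Definition nabla_riem (D : connection) (c : atlas M)
    (X Y Z W : 'rV[R]_m -> 'rV[R]_m) : 'rV[R]_m -> 'rV[R]_m :=
  fun x => nabla D c X (riem D c Y Z W) x
           - riem D c (nabla D c X Y) Z W x
           - riem D c Y (nabla D c X Z) W x
           - riem D c Y Z (nabla D c X W) x.

Definition levi_civita (g : metric) (D : connection) : Prop :=
  (forall c V X Y, local_vfield c V X -> local_vfield c V Y ->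
     forall x, V x -> nabla D c X Y x - nabla D c Y X x = bracket X Y x) /\
  (forall c V X Y Z,
     local_vfield c V X -> local_vfield c V Y -> local_vfield c V Z ->
     forall x, V x ->
       'D_(X x) (gprod g c Y Z) x
       = gprod g c (nabla D c X Y) Z x + gprod g c Y (nabla D c X Z) x).

(* The Lie derivative of g along xi vanishes. *)
Definition killing (g : metric) (xi : vfield) : Prop :=
  forall c V X Y, local_vfield c V X -> local_vfield c V Y ->
  forall x, V x ->
    'D_(xi c x) (gprod g c X Y) x
    = gprod g c (bracket (xi c) X) Y x + gprod g c X (bracket (xi c) Y) x.

Definition parallel (D : connection) (xi : vfield) : Prop :=
  forall c V X, local_vfield c V X -> forall x, V x -> nabla D c X (xi c) x = 0.

Definition in_perp (g : metric) (xi : vfield) (c : atlas M)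
    (V : set 'rV[R]_m) (X : 'rV[R]_m -> 'rV[R]_m) : Prop :=
  forall x, V x -> gprod g c (xi c) X x = 0.

(* R(X, Y) = 0 for all X, Y in the orthogonal of xi *)
Definition riem_perp_eq0 (g : metric) (D : connection) (xi : vfield) : Prop :=
  forall c V X Y Z,
    local_vfield c V X -> local_vfield c V Y -> local_vfield c V Z ->
    in_perp g xi c V X -> in_perp g xi c V Y ->
    forall x, V x -> riem D c X Y Z x = 0.

(* nabla_X R = 0 for all X in the orthogonal of xi *)
Definition nabla_riem_perp_eq0 (g : metric) (D : connection) (xi : vfield) :
    Prop :=
  forall c V X Y Z W,
    local_vfield c V X -> local_vfield c V Y ->
    local_vfield c V Z -> local_vfield c V W ->
    in_perp g xi c V X ->
    forall x, V x -> nabla_riem D c X Y Z W x = 0.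

Definition flat (D : connection) : Prop :=
  forall c V X Y Z,
    local_vfield c V X -> local_vfield c V Y -> local_vfield c V Z ->
    forall x, V x -> riem D c X Y Z x = 0.

(* Signature (-, +, ..., +) at every point. *)
Definition lorentzian (g : metric) : Prop :=
  forall c x, cod c x -> exists2 P : 'M[R]_m, P \in unitmx &
    P *m gram g c x *m P^T
    = diag_mx (\row_(i < m) if i == 0%N :> nat then -1 else 1).

Definition plane_wave (g : metric) : Prop :=
  lorentzian g /\
  exists D : connection,
    [/\ levi_civita g D, ~ flat D &
        exists xi : vfield,
          [/\ parallel D xi,
              forall c x, cod c x -> gprod g c (xi c) (xi c) x = 0,
              riem_perp_eq0 g D xi &
              nabla_riem_perp_eq0 g D xi]].

(* At each point, the values of xi0, xi_1, ..., xi_n span the orthogonal of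
   the value of xi0. *)
Definition span_perp (g : metric) (n : nat) (xi0 : vfield)
    (xi : 'I_n -> vfield) : Prop :=
  forall c x, cod c x -> forall v : 'rV[R]_m,
    form (gram g c x) (xi0 c x) v = 0 <->
    exists (a0 : R) (a : 'I_n -> R),
      v = a0 *: xi0 c x + \sum_(i < n) a i *: xi i c x.

End Geometry.

(* Main.v *)
Require Import Defs.
From HB Require Import structures.
From mathcomp Require Import all_boot all_order all_algebra.
From mathcomp Require Import all_classical all_reals all_analysis.
From mathcomp Require Import ring lra.
Set Implicit Arguments.
Unset Strict Implicit.
Unset Printing Implicit Defensive.
Import Order.TTheory GRing.Theory Num.Theory.
Import numFieldNormedType.Exports.
Local Open Scope classical_set_scope.
Local Open Scope ring_scope.

(** Write A_i for the endomorphism u |-> nabla_u xi_i, where i runs over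
    0, ..., n.  It is skew because xi_i is Killing, and one more derivative
    gives nabla_u A_i = R(u, xi_i) ([killing_second]).  The span hypothesis
    makes xi_0 null and nowhere zero, so its orthogonal is a hyperplane, the
    only vectors orthogonal to all xi_i are the multiples of xi_0
    ([perp_line]), and a skew endomorphism that kills every xi_i is zero
    ([skew_frame_eq0]).

    First derivatives.  The function g(nabla_{xi_i} xi_j, xi_l) is symmetric
    in i, j, because the brackets are multiples of xi_0, and skew in i, l,
    because xi_j is Killing; hence it vanishes ([cov_frame_perp]) and A_j maps
    the orthogonal of xi_0 into the line of xi_0.  Differentiating
    g(xi_0, xi_i) = 0 and using [xi_0, xi_i] = 0 gives A_0 xi_i = 0, so A_0 is
    a skew endomorphism that kills the frame: xi_0 is parallel ([cov_ord0]).

    Curvature.  Differentiating g(A_c xi_a, xi_b) = 0 in an arbitrary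
    direction u gives g(R(u, xi_c) xi_a, xi_b) = 0 ([curv_frame_perp]).  By
    the pair symmetry of R, the skew endomorphism R(xi_a, xi_b) kills the
    frame, hence vanishes ([curv_frame]).

    Derivative of the curvature.  Commuting two covariant derivatives of A_a
    expresses (nabla_{xi_c} R)(v, xi_a) as the commutator of R(xi_c, v) and
    A_a ([cov_curv_killing]); the other terms contain a derivative of
    R(xi_c, xi_a) = 0, or R with the argument xi_0 or with two arguments
    orthogonal to xi_0.  Both factors are skew, kill xi_0 and map the frame
    into the line of xi_0, so the commutator is skew and kills the frame: it
    is zero ([cov_curv_frame]).

    Everything takes place in one chart.  The test vectors u, v, w are
    constant there, so that their brackets vanish and tensors are families of
    multilinear maps; the analytic input is the Leibniz rule
    ([derive_apply]) and the symmetry of second derivatives ([schwarz_rV]). *)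

(** * Smooth maps on an open set *)

Section Scale.
Context {R : realType} {U W : normedModType R}.

Lemma scaler_is_bilinear : bilinear_for
  (GRing.Scale.Law.clone _ _ *:%R _) (GRing.Scale.Law.clone _ _ *:%R _)
  (@GRing.scale R W : R -> W -> W).
Proof.
split=> [u'|u] a x y /=; first by rewrite scalerDl scalerA.
by rewrite scalerDr !scalerA mulrC.
Qed.

HB.instance Definition _ := bilinear_isBilinear.Build R R W W _ _
  (@GRing.scale R W : R -> W -> W) scaler_is_bilinear.

Lemma is_diff_scaler (k dk : U -> R) (F dF : U -> W) x :
  is_diff x k dk -> is_diff x F dF ->
  is_diff x (fun y => k y *: F y) (fun v => k x *: dF v + dk v *: F x).
Proof.
move=> dkx dFx.
have sc : continuous (fun q : R * W => q.1 *: q.2) by exact: scale_continuous.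
have ds (p : R * W) : is_diff p (fun q : R * W => q.1 *: q.2)
    (fun q => p.1 *: q.2 + q.1 *: p.2).
  by apply: DiffDef; [exact: differentiable_bilin | exact: diff_bilin].
exact: (@is_diff_comp _ _ _ _ (fun y => (k y, F y)) _ _ _ x _ (ds _)).
Qed.

Lemma differentiable_scaler (k : U -> R) (F : U -> W) x :
  differentiable k x -> differentiable F x ->
  differentiable (fun y => k y *: F y) x.
Proof.
by move=> /differentiableP dk /differentiableP dF; have [] := is_diff_scaler dk dF.
Qed.

Lemma derive_scaler (k : U -> R) (F : U -> W) x v :
  differentiable k x -> differentiable F x ->
  'D_v (fun y => k y *: F y) x = 'D_v k x *: F x + k x *: 'D_v F x.
Proof.
move=> dk dF; rewrite !deriveE//; last exact: differentiable_scaler.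
have [_ ->] := is_diff_scaler (differentiableP dk) (differentiableP dF).
by rewrite addrC.
Qed.

End Scale.

Section Smooth.
Context {R : realType} {U : normedModType R} (V : set U) (Vo : open V).

Lemma near_in_open (x : U) (P : U -> Prop) : V x -> (forall y, V y -> P y) ->
  \forall y \near x, P y.
Proof. by move=> Vx VP; apply: filterS (open_nbhs_nbhs (conj Vo Vx)). Qed.

Lemma derive_ext (W : normedModType R) (f g : U -> W) (x v : U) : V x ->
  (forall y, V y -> f y = g y) -> 'D_v f x = 'D_v g x.
Proof. by move=> Vx fg; apply: near_eq_derive; apply: near_in_open. Qed.

(** Differentiability is a local property: the zero differential is exhibited
    here, and [differentiable_ext] follows by adding the difference of the two
    maps. *)
Lemma differentiable_near0 (W : normedModType R) (f : U -> W) (x : U) : V x ->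
  (forall y, V y -> f y = 0) -> differentiable f x.
Proof.
move=> Vx f0.
have fo : f \o shift x = cst (f x) + (\0 : {linear U -> W}) +o_ (0 : U) id.
  apply/eqaddoP => _/posnumP[e].
  have : \forall y \near x, f y = 0 by exact: near_in_open.
  rewrite (near_shift 0) /= subr0; apply: filterS => y /= fy.
  by rewrite !fctE /= fy f0// addr0 subr0 normr0 mulr_ge0.
have d0 : 'd f x = \0 :> (U -> W)
  by apply: diff_unique => //; exact: cst_continuous.
by apply/diff_locallyP; rewrite d0; split=> //; exact: cst_continuous.
Unshelve. all: by end_near. Qed.

Lemma differentiable_ext (W : normedModType R) (f g : U -> W) (x : U) : V x ->
  (forall y, V y -> f y = g y) -> differentiable f x -> differentiable g x.
Proof.
move=> Vx fg df.
have -> : g = f + (g - f) by rewrite addrC subrK.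
apply: differentiableD => //; apply: differentiable_near0 => // y Vy.
by rewrite !fctE fg// subrr.
Qed.

Lemma Cn_ext (W : normedModType R) k (f g : U -> W) :
  (forall y, V y -> f y = g y) ->
  Cn_on k V f -> Cn_on k V g.
Proof.
elim: k f g => [|k IH] f g fg /=.
  move=> fc x Vx; suff : g @ x --> g x by []. rewrite -(fg _ Vx).
  apply: cvg_trans (fc x Vx); apply: near_eq_cvg.
  by apply: (near_in_open Vx) => y Vy; exact: fg.
case=> df Df; split=> [x Vx|v]; first exact: differentiable_ext (df x Vx).
by apply: IH (Df v) => y Vy; exact: derive_ext.
Qed.

(** [Cn_on] asks for continuity only at rank 0; at positive rank it comes from
    differentiability. *)
Lemma CnS (W : normedModType R) k (f : U -> W) : Cn_on k.+1 V f -> Cn_on k V f.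
Proof.
elim: k f => [|k IH] f /= [df Df].
  by move=> x Vx; apply: differentiable_continuous; exact: df.
by split=> // v; apply: IH; exact: Df.
Qed.

Lemma Cn_cst (W : normedModType R) k (w : W) : Cn_on k V (fun=> w).
Proof.
elim: k w => [|k IH] w /=; first by move=> x _; exact: cst_continuous.
split=> [x _|v]; first exact: differentiable_cst.
by apply: Cn_ext (IH 0) => y _; exact/esym/derive_cst.
Qed.

Lemma CnD (W : normedModType R) k (f g : U -> W) : Cn_on k V f -> Cn_on k V g ->
  Cn_on k V (fun x => f x + g x).
Proof.
elim: k f g => [|k IH] f g /=.
  by move=> fc gc x Vx; apply: continuousD; [exact: fc|exact: gc].
move=> [df Df] [dg Dg]; split=> [x Vx|v].
  by apply: differentiableD; [exact: df|exact: dg].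
apply: Cn_ext (IH _ _ (Df v) (Dg v)) => y Vy.
by rewrite -deriveD//; apply: diff_derivable; [exact: df|exact: dg].
Qed.

Lemma CnZ (W : normedModType R) k (f : U -> R) (g : U -> W) :
  Cn_on k V f -> Cn_on k V g ->
  Cn_on k V (fun x => f x *: g x).
Proof.
elim: k f g => [|k IH] f g.
  by move=> fc gc x Vx; apply: continuousZ; [exact: fc|exact: gc].
move=> Cf Cg; have [fk gk] := (CnS Cf, CnS Cg).
move: Cf Cg => [df Df] [dg Dg]; split=> [x Vx|v].
  by apply: differentiable_scaler; [exact: df|exact: dg].
apply: Cn_ext (CnD (IH _ _ (Df v) gk) (IH _ _ fk (Dg v))) => y Vy.
by rewrite derive_scaler//; [exact: df|exact: dg].
Qed.

Lemma smooth_ext (W : normedModType R) (f g : U -> W) :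
  (forall y, V y -> f y = g y) ->
  smooth_on V f -> smooth_on V g.
Proof. by move=> fg sf k; exact: Cn_ext (sf k). Qed.

Lemma smooth_cst (W : normedModType R) (w : W) : smooth_on V (fun=> w).
Proof. by move=> k; exact: Cn_cst. Qed.

Lemma smoothD (W : normedModType R) (f g : U -> W) :
  smooth_on V f -> smooth_on V g ->
  smooth_on V (fun x => f x + g x).
Proof. by move=> sf sg k; exact: CnD. Qed.

Lemma smoothZ (W : normedModType R) (f : U -> R) (g : U -> W) :
  smooth_on V f -> smooth_on V g ->
  smooth_on V (fun x => f x *: g x).
Proof. by move=> sf sg k; exact: CnZ. Qed.

Lemma smooth_sum (W : normedModType R) n (f : 'I_n -> U -> W) :
  (forall i, smooth_on V (f i)) ->
  smooth_on V (fun x => \sum_i f i x).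
Proof.
elim: n f => [|n IH] f sf.
  by apply: smooth_ext (smooth_cst 0) => y _; rewrite big_ord0.
apply: smooth_ext (smoothD (IH _ (fun i => sf (widen_ord (leqnSn n) i)))
  (sf ord_max)) => y _.
by rewrite big_ord_recr.
Qed.

Lemma smooth_differentiable (W : normedModType R) (f : U -> W) x : smooth_on V f -> V x ->
  differentiable f x.
Proof. by move=> sf Vx; have [df _] := sf 1%N; exact: df. Qed.

Lemma smooth_derivable (W : normedModType R) (f : U -> W) x v : smooth_on V f -> V x ->
  derivable f x v.
Proof. by move=> sf Vx; apply/diff_derivable/smooth_differentiable. Qed.

Lemma smooth_derive (W : normedModType R) (f : U -> W) v : smooth_on V f ->
  smooth_on V (fun x => 'D_v f x).
Proof. by move=> sf k; have [_] := sf k.+1; exact. Qed.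

Lemma smooth_sub (W : normedModType R) (V' : set U) (f : U -> W) :
  V' `<=` V -> smooth_on V f ->
  smooth_on V' f.
Proof.
move=> VV sf k; have := sf k; elim: k f {sf} => [|k IH] f /=.
  by move=> fc x /VV; exact: fc.
by case=> df Df; split=> [x /VV|v]; [exact: df|exact: IH].
Qed.

End Smooth.

Section SmoothCoord.
Context {R : realType} {U : normedModType R} (V : set U) (Vo : open V).

Lemma smoothN (W : normedModType R) (f : U -> W) :
  smooth_on V f -> smooth_on V (fun x => - f x).
Proof.
move=> sf; apply: smooth_ext (smoothZ Vo (smooth_cst Vo (-1 : R)) sf) => // y _.
by rewrite scaleN1r.
Qed.

Lemma smoothB (W : normedModType R) (f g : U -> W) :
  smooth_on V f -> smooth_on V g -> smooth_on V (fun x => f x - g x).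
Proof. by move=> sf sg; apply: smoothD => //; exact: smoothN. Qed.

Lemma smooth_coord m n (f : U -> 'M[R]_(m, n)) i j :
  smooth_on V f -> smooth_on V (fun x => f x i j).
Proof.
move=> sf k; have := sf k; elim: k f {sf} => [|k IH] f /=.
  move=> fc x Vx.
  apply: (@continuous_comp _ _ _ f (fun N : 'M[R]_(m, n) => N i j) x (fc x Vx)).
  exact: coord_continuous.
case=> df Df; split=> [x Vx|v].
  exact: (@differentiable_comp _ _ _ _ f (fun N : 'M[R]_(m, n) => N i j)
    x (df x Vx) (differentiable_coord _ _ _)).
apply: Cn_ext (IH _ (Df v)) => // y Vy.
by rewrite derive_mx ?mxE//; exact/diff_derivable/df.
Qed.

Lemma derive_linear (W : normedModType R) (f : U -> W) x : differentiable f x ->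
  linear (fun v => 'D_v f x).
Proof. by move=> df a u v; rewrite !deriveE// linearP. Qed.

End SmoothCoord.

(** The maps of this file are linear for fixed base point only, and are not
    bundled; these are the usual consequences of the predicate [linear]. *)
Section LinearMaps.
Context {R : realType} {U W : lmodType R} (f : U -> W) (fl : linear f).

Lemma lin0 : f 0 = 0.
Proof. by have := fl (-1) 0 0; rewrite !scaleN1r oppr0 addr0 addNr. Qed.

Lemma linZ a u : f (a *: u) = a *: f u.
Proof. by have := fl a u 0; rewrite lin0 !addr0. Qed.

Lemma linD u v : f (u + v) = f u + f v.
Proof. by have := fl 1 u v; rewrite !scale1r. Qed.

Lemma linN u : f (- u) = - f u.
Proof. by rewrite -scaleN1r linZ scaleN1r. Qed.

Lemma linB u v : f (u - v) = f u - f v.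
Proof. by rewrite linD linN. Qed.

Lemma lin_sum n (F : 'I_n -> U) : f (\sum_i F i) = \sum_i f (F i).
Proof.
elim: n F => [|n IH] F; first by rewrite !big_ord0 lin0.
by rewrite !big_ord_recr /= linD IH.
Qed.

End LinearMaps.

Section Apply.
Context {R : realType} {m : nat} {W : normedModType R}.
Context (V : set 'rV[R]_m) (Vo : open V).
Variables (T : 'rV[R]_m -> 'rV[R]_m -> W) (Y : 'rV[R]_m -> 'rV[R]_m).
Hypotheses (Tl : forall x, V x -> linear (T x))
  (Ts : forall v, smooth_on V (fun x => T x v)) (Ys : smooth_on V Y).

Let applyE x : V x -> \sum_j Y x 0 j *: T x (delta_mx 0 j) = T x (Y x).
Proof.
move=> Vx; rewrite [in RHS](row_sum_delta (Y x)) (lin_sum (Tl Vx)).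
by apply: eq_bigr => j _; rewrite (linZ (Tl Vx)).
Qed.

Lemma smooth_apply : smooth_on V (fun x => T x (Y x)).
Proof.
apply: (smooth_ext Vo applyE); apply: smooth_sum => // j.
by apply: smoothZ => //; exact: smooth_coord.
Qed.

(** Leibniz rule for a vector field inserted in a linear slot: the point enters
    through the family [T] and through the field [Y].  Expanding [Y] in the
    standard basis reduces it to products of a function by a map. *)
Lemma derive_apply u x : V x ->
  'D_u (fun y : 'rV[R]_m => T y (Y y)) x
  = 'D_u (fun y : 'rV[R]_m => T y (Y x)) x + T x ('D_u Y x).
Proof.
move=> Vx.
have sY j : smooth_on V (fun y : 'rV[R]_m => Y y 0 j) by exact: smooth_coord.
have E y : V y -> T y (Y x) = \sum_j Y x 0 j *: T y (delta_mx 0 j).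
  move=> Vy; rewrite [in LHS](row_sum_delta (Y x)) (lin_sum (Tl Vy)).
  by apply: eq_bigr => j _; rewrite (linZ (Tl Vy)).
rewrite -(derive_ext Vo u Vx applyE) (derive_ext Vo u Vx E).
have ds (F : 'I_m -> 'rV[R]_m -> W) : (forall j, smooth_on V (F j)) ->
    'D_u (fun y : 'rV[R]_m => \sum_j F j y) x = \sum_j 'D_u (F j) x.
  move=> sF; rewrite -derive_sum => [|j]; last exact: smooth_derivable (sF j) Vx.
  by congr ('D_u _ x); apply/funext => y; rewrite fct_sumE.
rewrite !ds => [|j|j]; last 2 first.
- by apply: smoothZ => //; exact: smooth_cst.
- exact: smoothZ.
rewrite [X in T x X](row_sum_delta) (lin_sum (Tl Vx)) -big_split /=.
apply: eq_bigr => j _; rewrite (linZ (Tl Vx)) derive_scaler; last 2 first.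
- exact: smooth_differentiable (sY j) Vx.
- exact: smooth_differentiable (Ts _) Vx.
rewrite derive_scaler; last 2 first.
- exact: differentiable_cst.
- exact: smooth_differentiable (Ts _) Vx.
rewrite derive_cst scale0r add0r addrC; congr (_ + _ *: _).
by rewrite derive_mx ?mxE//; exact: smooth_derivable Ys Vx.
Qed.

End Apply.

(** * Symmetry of second derivatives *)

Section Schwarz.
Context {R : realType} {U : normedModType R} (V : set U) (Vo : open V).

(** Restriction to a line, to which the one-variable mean value theorem
    applies. *)
Lemma is_derive_line (f : U -> R) (p u : U) (s : R) :
  differentiable f (s *: u + p) ->
  is_derive s 1 (fun t => f (t *: u + p)) ('D_u f (s *: u + p)).
Proof.
move=> df.
have E : (fun h : R => h^-1 *: (f ((h *: 1 + s) *: u + p) - f (s *: u + p)))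
  = (fun h => h^-1 *: (f (h *: u + (s *: u + p)) - f (s *: u + p))).
  by apply/funext => h; rewrite scalerDl addrA /= [_ *: 1]mulr1.
apply: DeriveDef; last by rewrite /derive /= E.
by rewrite /derivable /= E; exact: diff_derivable.
Qed.

(** Applying the mean value theorem in the direction [u], then in the direction
    [v], turns the second difference of [f] over a parallelogram into a mixed
    derivative at one of its points. *)
Lemma second_difference (f : U -> R) (x u v : U) (h : R) : 0 < h ->
  smooth_on V f ->
  (forall s t, 0 <= s <= h -> 0 <= t <= h -> V (s *: u + (t *: v + x))) ->
  exists s t, [/\ 0 <= s <= h, 0 <= t <= h &
    f (h *: u + (h *: v + x)) - f (h *: u + x) - f (h *: v + x) + f x
    = 'D_v (fun y => 'D_u f y) (t *: v + (s *: u + x)) * h ^+ 2].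
Proof.
move=> h0 sf inV.
have h00 : (0 : R) <= 0 <= h by rewrite lexx ltW.
have inV0 s : 0 <= s <= h -> V (s *: u + x).
  by move=> sh; have := inV s 0 sh h00; rewrite scale0r add0r.
have inV' s t : 0 <= s <= h -> 0 <= t <= h -> V (t *: v + (s *: u + x)).
  by move=> sh th; rewrite addrCA; exact: inV.
have df y : V y -> differentiable f y by exact: smooth_differentiable.
have ddf y : V y -> differentiable (fun y => 'D_u f y) y.
  by apply: smooth_differentiable; exact: smooth_derive.
have hh : 0 <= h <= h by rewrite lexx ltW.
have dphi s : 0 <= s <= h -> is_derive s 1
    ((fun t : R => f (t *: u + (h *: v + x))) - (fun t => f (t *: u + x)))
    ('D_u f (s *: u + (h *: v + x)) - 'D_u f (s *: u + x)).
  move=> sh; apply: is_deriveB; apply: is_derive_line; apply: df.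
    exact: inV.
  exact: inV0.
have MVT0 (g dg : R -> R) : (forall s, 0 <= s <= h -> is_derive s 1 g (dg s)) ->
    exists2 s, 0 <= s <= h & g h - g 0 = dg s * h.
  move=> gd.
  have [||s] := @MVT_segment R g dg 0 h (ltW h0).
  - by move=> s; rewrite in_itv /= => /andP[/ltW s0 /ltW sh]; apply: gd; rewrite s0.
  - apply: derivable_within_continuous => s; rewrite in_itv /= => sh.
    by have [] := gd s sh.
  by rewrite in_itv /= subr0 => sh ->; exists s.
have [s sh] := MVT0 _ _ dphi.
rewrite !fctE !scale0r !add0r => Es.
have dpsi t : 0 <= t <= h -> is_derive t 1
    (fun t : R => 'D_u f (t *: v + (s *: u + x)))
    ('D_v (fun y => 'D_u f y) (t *: v + (s *: u + x))).
  by move=> th; apply: is_derive_line; apply: ddf; exact: inV'.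
have [t th] := MVT0 _ _ dpsi.
rewrite scale0r add0r => Et.
exists s, t; split=> //; rewrite expr2 mulrA -Et (addrCA (h *: v)) -Es.
by rewrite opprB (addrA _ (f x)) (addrAC _ (f x)).
Qed.

(** If the same second difference [D] is measured by [G] at a point of each small
    parallelogram and by [F] at another, then [F] and [G] agree in the limit. *)
Lemma eq_of_second_difference (F G : U -> R) (D : R -> R) (x u v : U) : V x ->
  {for x, continuous F} -> {for x, continuous G} ->
  (forall h, 0 < h ->
    (forall s t, 0 <= s <= h -> 0 <= t <= h -> V (s *: u + (t *: v + x))) ->
    exists s t, [/\ 0 <= s <= h, 0 <= t <= h &
      D h = G (t *: v + (s *: u + x)) * h ^+ 2]) ->
  (forall h, 0 < h ->
    (forall s t, 0 <= s <= h -> 0 <= t <= h -> V (s *: v + (t *: u + x))) ->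
    exists s t, [/\ 0 <= s <= h, 0 <= t <= h &
      D h = F (t *: u + (s *: v + x)) * h ^+ 2]) ->
  F x = G x.
Proof.
move=> Vx cF cG sdG sdF.
have [n0 nV] : 0 < `|u| + `|v| + 1 /\ \forall y \near x, V y.
  by split; [rewrite ltr_wpDl// addr_ge0|exact: (near_in_open Vo Vx)].
apply/eqP; rewrite -subr_eq0 -normr_le0; apply/ler_addgt0Pr => e e0.
rewrite add0r.
have e2 : 0 < e / 2 by rewrite divr_gt0.
have /nbhs_ballP[r /= r0 Hr] : nbhs x (V `&` ([set y | `|F y - F x| < e / 2] `&`
    [set y | `|G y - G x| < e / 2])).
  apply: filterI => //; apply: filterI.
    by have /cvgrPdistC_lt/(_ _ e2) := cF.
  by have /cvgrPdistC_lt/(_ _ e2) := cG.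
(* The parallelogram of side h at x stays in the ball of radius r. *)
pose h := r / (`|u| + `|v| + 1).
have h0 : 0 < h by rewrite divr_gt0.
have small s t : 0 <= s <= h -> 0 <= t <= h ->
    ball x r (s *: u + (t *: v + x)).
  move=> /andP[s0 sh] /andP[t0 th].
  rewrite -ball_normE /= addrA opprD addrCA subrr addr0 normrN.
  apply: le_lt_trans (ler_normD _ _) _; rewrite !normrZ !ger0_norm//.
  apply: (@le_lt_trans _ _ (h * (`|u| + `|v|))).
    by rewrite mulrDr lerD// ler_wpM2r.
  by rewrite /h mulrAC ltr_pdivrMr// ltr_pM2l// ltrDl.
have sV s t : 0 <= s <= h -> 0 <= t <= h -> V (s *: u + (t *: v + x)).
  by move=> sh th; have [] := Hr _ (small s t sh th).
have sV' s t : 0 <= s <= h -> 0 <= t <= h -> V (s *: v + (t *: u + x)).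
  by move=> sh th; rewrite addrCA; exact: sV.
have [s [t [sh th Est]]] := sdG h h0 sV.
have [s' [t' [sh' th' Est']]] := sdF h h0 sV'.
have E : G (t *: v + (s *: u + x)) = F (t' *: u + (s' *: v + x)).
  apply: (mulIf (expf_neq0 2 (lt0r_neq0 h0))).
  by rewrite -Est -Est'.
have [_ [_ /= A]] := Hr _ (small s t sh th).
have [_ [/= B _]] := Hr _ (small t' s' th' sh').
rewrite addrCA E in A; rewrite (splitr e).
apply: le_trans (lerD (ltW B) (ltW A)); rewrite [in leRHS](distrC _ (F x)).
exact: ler_distD.
Qed.

Lemma schwarz_scalar (f : U -> R) (x u v : U) : V x -> smooth_on V f ->
  'D_u (fun y => 'D_v f y) x = 'D_v (fun y => 'D_u f y) x.
Proof.
move=> Vx sf.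
have cD a b : {for x, continuous (fun y => 'D_a (fun z => 'D_b f z) y)}.
  have sD : smooth_on V (fun y => 'D_a (fun z => 'D_b f z) y).
    by do 2!apply: smooth_derive.
  exact: (sD 0%N x Vx).
apply: (eq_of_second_difference (D := fun h =>
  f (h *: u + (h *: v + x)) - f (h *: u + x) - f (h *: v + x) + f x)
  Vx (cD u v) (cD v u)) => h h0 hV.
  exact: second_difference.
rewrite addrCA (addrAC (f (h *: v + _))); exact: second_difference.
Qed.

Lemma schwarz_rV m (f : U -> 'rV[R]_m) (x u v : U) : V x -> smooth_on V f ->
  'D_u (fun y => 'D_v f y) x = 'D_v (fun y => 'D_u f y) x.
Proof.
move=> Vx sf; apply/rowP => j.
have sfj : smooth_on V (fun y => f y 0 j) by exact: smooth_coord.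
have E a b : 'D_a (fun y => 'D_b f y) x 0 j
    = 'D_a (fun y => 'D_b (fun y => f y 0 j) y) x.
  rewrite derive_mx ?mxE; last exact: smooth_derivable (smooth_derive _ sf) Vx.
  apply: (derive_ext Vo) => // y Vy.
  by rewrite derive_mx ?mxE//; exact: smooth_derivable sf Vy.
apply: (etrans (E u v)).
apply: (etrans _ (esym (E v u))).
exact: (schwarz_scalar u v Vx sfj).
Qed.
End Schwarz.

(** * Covariant derivative and curvature in a chart *)

(** An identity between vectors is checked entry by entry with [ring].  The
    maximal subterms that are not built by the module operations are first
    replaced by variables: [ring] compares its atoms up to conversion, which is
    slow on derivatives. *)
Ltac abstract_atoms e :=
  lazymatch e with
  | (?a + ?b)%R => abstract_atoms a; abstract_atoms b
  | (- ?a)%R => abstract_atoms a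
  | (_ *: ?a)%R => abstract_atoms a
  | 0%R => idtac
  | _ => first [is_var e | generalize e; intro]
  end.

Ltac rowring :=
  cbn beta;
  lazymatch goal with
  | |- ?a = _ => abstract_atoms a;
      lazymatch goal with |- _ = ?b => abstract_atoms b end
  end; apply/rowP => ?; rewrite !mxE; ring.

Ltac rowlra :=
  cbn beta;
  lazymatch goal with
  | |- ?c = _ -> _ => abstract_atoms c;
      lazymatch goal with |- _ = ?d -> _ => abstract_atoms d;
      lazymatch goal with |- _ -> ?a = _ => abstract_atoms a;
      lazymatch goal with |- _ -> _ = ?b => abstract_atoms b end end end
  end;
  let H := fresh in move=> H; apply/rowP => j; move/rowP: H => /(_ j);
  rewrite !mxE; lra.

Ltac abstract_values f :=
  repeat match goal with
  | |- context [f ?x ?a ?b] => generalize (f x a b); intro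
  end.

Section FamilyDerivative.
Context {R : realType} {m : nat} {W : normedModType R}.
Context (V : set 'rV[R]_m) (Vo : open V).

Lemma derive_family_linear (T : 'rV[R]_m -> 'rV[R]_m -> W) t x : V x ->
  (forall y, V y -> linear (T y)) ->
  (forall v, smooth_on V (fun y : 'rV[R]_m => T y v)) ->
  linear (fun v => 'D_t (fun y : 'rV[R]_m => T y v) x).
Proof.
move=> Vx Tl Ts a u v.
rewrite (derive_ext Vo t Vx (fun y Vy => Tl y Vy a u v)).
have sd w : differentiable (fun y : 'rV[R]_m => T y w) x
  by exact: smooth_differentiable (Ts w) Vx.
rewrite (deriveD (f := fun y => a *: T y u)); last 2 first.
- by apply: diff_derivable; apply: differentiableZ.
- exact: diff_derivable.
by rewrite (deriveZ (f := fun y => T y u))//; exact: diff_derivable.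
Qed.

End FamilyDerivative.

Section Curvature.
Context {R : realType} {m : nat}.
Implicit Types (u v w t x : 'rV[R]_m) (X Y Z K : 'rV[R]_m -> 'rV[R]_m).
Variable Gam : 'rV[R]_m -> 'rV[R]_m -> 'rV[R]_m -> 'rV[R]_m.

(** The covariant derivative of [Y] in the direction [u], at a point. *)
Definition cov u Y x := 'D_u Y x + Gam x u (Y x).

(** R(u, v)w for constant fields [u], [v], [w], whose brackets vanish. *)
Definition curv x u v w :=
  'D_u (fun y : 'rV[R]_m => Gam y v w) x - 'D_v (fun y : 'rV[R]_m => Gam y u w) x
  + Gam x u (Gam x v w) - Gam x v (Gam x u w).

(** (nabla_t T)(w), for a field [T] of endomorphisms. *)
Definition cov_endo (T : 'rV[R]_m -> 'rV[R]_m -> 'rV[R]_m) t w x :=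
  cov t (fun y : 'rV[R]_m => T y w) x - T x (Gam x t w).

(** (nabla_t R)(u, v)w. *)
Definition cov_curv x t u v w :=
  cov t (fun y : 'rV[R]_m => curv y u v w) x
  - curv x (Gam x t u) v w - curv x u (Gam x t v) w - curv x u v (Gam x t w).

Context (V : set 'rV[R]_m) (Vo : open V).
Hypotheses (Gl : forall x, V x -> forall v, linear (fun u => Gam x u v))
  (Gr : forall x, V x -> forall u, linear (Gam x u))
  (Gs : forall u v, smooth_on V (fun x => Gam x u v))
  (Gsym : forall x, V x -> forall u v, Gam x u v = Gam x v u).

Lemma smooth_christoffel Y Z : smooth_on V Y -> smooth_on V Z ->
  smooth_on V (fun x => Gam x (Y x) (Z x)).
Proof.
move=> sY sZ.
apply: (smooth_apply Vo (T := fun x v => Gam x v (Z x))) => // [x Vx|v].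
  exact: Gl.
by apply: (smooth_apply Vo (T := fun x w => Gam x v w)) => // x Vx; exact: Gr.
Qed.

Lemma smooth_cov u Y : smooth_on V Y -> smooth_on V (cov u Y).
Proof.
move=> sY; apply: smoothD => //; first exact: smooth_derive.
by apply: smooth_christoffel => //; exact: smooth_cst.
Qed.

Lemma cov_linear Y x : smooth_on V Y -> V x -> linear (fun u => cov u Y x).
Proof.
move=> sY Vx a u v; rewrite /cov (derive_linear (smooth_differentiable sY Vx)).
by rewrite Gl//; rowring.
Qed.

Lemma cov_ext u Y Z x : V x -> (forall y, V y -> Y y = Z y) ->
  cov u Y x = cov u Z x.
Proof. by move=> Vx YZ; rewrite /cov (derive_ext Vo u Vx YZ) YZ. Qed.

Lemma covB u Y Z x : smooth_on V Y -> smooth_on V Z -> V x ->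
  cov u (fun y : 'rV[R]_m => Y y - Z y) x = cov u Y x - cov u Z x.
Proof.
move=> sY sZ Vx; rewrite /cov (linB (Gr Vx u)).
rewrite (deriveB (f := Y)); last 2 first.
- exact: smooth_derivable sY Vx.
- exact: smooth_derivable sZ Vx.
by rowring.
Qed.

Lemma cov_cst u w x : cov u (fun=> w) x = Gam x u w.
Proof. by rewrite /cov derive_cst add0r. Qed.

Lemma cov_apply T Y t x : V x -> (forall y, V y -> linear (T y)) ->
  (forall v, smooth_on V (fun y : 'rV[R]_m => T y v)) -> smooth_on V Y ->
  cov t (fun y : 'rV[R]_m => T y (Y y)) x = cov_endo T t (Y x) x + T x (cov t Y x).
Proof.
move=> Vx Tl Ts sY; rewrite /cov_endo /cov (derive_apply Vo)// (linD (Tl x Vx)).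
by rowring.
Qed.

Lemma cov_family_linear T t x : V x -> (forall y, V y -> linear (T y)) ->
  (forall v, smooth_on V (fun y : 'rV[R]_m => T y v)) ->
  linear (fun v => cov t (fun y : 'rV[R]_m => T y v) x).
Proof.
move=> Vx Tl Ts a u v; rewrite /cov (derive_family_linear Vo t Vx Tl Ts).
by rewrite (Tl x Vx) Gr//; rowring.
Qed.

(** Expanding both sides, the second derivatives of [Y] cancel by symmetry and
    the terms in the first derivatives of [Y] cancel in pairs, so that the
    commutator only depends on the value of [Y] at the point. *)
Lemma ricci u v Y x : V x -> smooth_on V Y ->
  cov u (cov v Y) x - cov v (cov u Y) x = curv x u v (Y x).
Proof.
move=> Vx sY.
have E a b : cov a (cov b Y) x = 'D_a ('D_b Y) x
    + 'D_a (fun y : 'rV[R]_m => Gam y b (Y x)) x + Gam x b ('D_a Y x)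
    + Gam x a ('D_b Y x) + Gam x a (Gam x b (Y x)).
  rewrite {1}/cov (linD (Gr Vx a)).
  rewrite (deriveD (f := 'D_b Y) (g := fun y => Gam y b (Y y))); last 2 first.
  - exact: smooth_derivable (smooth_derive _ sY) Vx.
  - apply: smooth_derivable Vx.
    by apply: smooth_christoffel => //; exact: smooth_cst.
  rewrite (derive_apply Vo (T := fun y w => Gam y b w) (Y := Y))//; last first.
    by move=> y Vy; exact: Gr.
  by rewrite /cov !addrA.
rewrite (E u v) (E v u) (schwarz_rV Vo u v Vx sY) /curv; rowring.
Qed.

Lemma curvC x u v w : curv x u v w = - curv x v u w.
Proof. by rewrite /curv; rowring. Qed.

Lemma curv_covE x u v w : V x -> curv x u v w =
  cov u (fun y : 'rV[R]_m => Gam y v w) x - cov v (fun y : 'rV[R]_m => Gam y u w) x.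
Proof. by move=> Vx; rewrite /cov /curv; rowring. Qed.

Lemma smooth_curv u v w : smooth_on V (fun x => curv x u v w).
Proof.
apply: (smooth_ext Vo (fun x Vx => esym (curv_covE u v w Vx))).
by apply: smoothB => //; exact: smooth_cov.
Qed.

Lemma curv_linear2 x u w : V x -> linear (fun v => curv x u v w).
Proof.
move=> Vx a v v'; rewrite !curv_covE//.
rewrite (cov_family_linear u Vx (T := fun y v => Gam y v w)) //.
  by rewrite (cov_linear (Y := fun y => Gam y u w))//; rowring.
by move=> y Vy; exact: Gl.
Qed.

Lemma curv_linear1 x v w : V x -> linear (fun u => curv x u v w).
Proof.
by move=> Vx a u u'; rewrite 3!(curvC x _ v) (curv_linear2 v w Vx); rowring.
Qed.

Lemma curv_linear3 x u v : V x -> linear (curv x u v).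
Proof.
move=> Vx a w w'; rewrite !curv_covE//.
rewrite (cov_family_linear u Vx (T := fun y w => Gam y v w)) //; last first.
  by move=> y Vy; exact: Gr.
rewrite (cov_family_linear v Vx (T := fun y w => Gam y u w)) //; last first.
  by move=> y Vy; exact: Gr.
by rowring.
Qed.

Lemma bianchi x u v w : V x -> curv x u v w + curv x v w u + curv x w u v = 0.
Proof.
move=> Vx.
have S a b c : 'D_a (fun y : 'rV[R]_m => Gam y b c) x
    = 'D_a (fun y : 'rV[R]_m => Gam y c b) x.
  by apply: (derive_ext Vo) => // y Vy; exact: Gsym.
rewrite /curv (S w u v) (S u v w) (S v w u).
by rewrite (Gsym Vx u v) (Gsym Vx v w) (Gsym Vx w u); rowring.
Qed.

Lemma smooth_curv_apply X Y Z : smooth_on V X -> smooth_on V Y ->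
  smooth_on V Z -> smooth_on V (fun x => curv x (X x) (Y x) (Z x)).
Proof.
move=> sX sY sZ.
apply: (smooth_apply Vo (T := fun x u => curv x u (Y x) (Z x))) => //.
  by move=> x Vx; exact: curv_linear1.
move=> u; apply: (smooth_apply Vo (T := fun x v => curv x u v (Z x))) => //.
  by move=> x Vx; exact: curv_linear2.
move=> v; apply: (smooth_apply Vo (T := fun x w => curv x u v w)) => //.
  by move=> x Vx; exact: curv_linear3.
by move=> w; exact: smooth_curv.
Qed.

Lemma cov_curv_apply t X Y Z x : V x -> smooth_on V X -> smooth_on V Y ->
  smooth_on V Z ->
  cov t (fun y : 'rV[R]_m => curv y (X y) (Y y) (Z y)) x =
    cov_curv x t (X x) (Y x) (Z x) + curv x (cov t X x) (Y x) (Z x)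
    + curv x (X x) (cov t Y x) (Z x) + curv x (X x) (Y x) (cov t Z x).
Proof.
move=> Vx sX sY sZ.
have c w : smooth_on V (fun=> w) by exact: smooth_cst.
rewrite (cov_apply (T := fun y u => curv y u (Y y) (Z y)))//; last 2 first.
- by move=> y Vy; exact: curv_linear1.
- by move=> v; exact: smooth_curv_apply.
rewrite /cov_endo.
rewrite (cov_apply (T := fun y v => curv y (X x) v (Z y)))//; last 2 first.
- by move=> y Vy; exact: curv_linear2.
- by move=> v; exact: smooth_curv_apply.
rewrite /cov_endo.
rewrite (cov_apply (T := fun y w => curv y (X x) (Y x) w))//; last 2 first.
- by move=> y Vy; exact: curv_linear3.
- by move=> v; exact: smooth_curv_apply.
by rewrite /cov_endo /cov_curv; rowring.
Qed.

Lemma smooth_cov_field X Y : smooth_on V X -> smooth_on V Y ->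
  smooth_on V (fun x => cov (X x) Y x).
Proof.
move=> sX sY; apply: (smooth_apply Vo (T := fun x u => cov u Y x)) => //.
  by move=> x Vx; exact: cov_linear.
by move=> u; exact: smooth_cov.
Qed.

(** Tensoriality of the curvature: the derivatives of [X] and [Y] produced by
    the Leibniz rule are those of the bracket term. *)
Lemma curv_fields X Y Z x : V x -> smooth_on V X -> smooth_on V Y ->
  smooth_on V Z ->
  cov (X x) (fun y : 'rV[R]_m => cov (Y y) Z y) x
  - cov (Y x) (fun y : 'rV[R]_m => cov (X y) Z y) x
  - cov (bracket X Y x) Z x = curv x (X x) (Y x) (Z x).
Proof.
move=> Vx sX sY sZ; pose T := fun y u : 'rV[R]_m => cov u Z y.
have Tl y : V y -> linear (T y) by exact: cov_linear.
have Ts u : smooth_on V (fun y => T y u) by exact: smooth_cov.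
rewrite (cov_apply (X x) Vx Tl Ts sY) (cov_apply (Y x) Vx Tl Ts sX).
have -> : bracket X Y x = cov (X x) Y x - cov (Y x) X x.
  by rewrite /bracket /cov (Gsym Vx (X x)); rowring.
have TE a b : cov_endo T a b x = cov a (cov b Z) x - cov (Gam x a b) Z x by [].
rewrite (linB (cov_linear sZ Vx)) -ricci// (TE (X x)) (TE (Y x)) /T.
by rewrite (Gsym Vx (X x)); rowring.
Qed.

Lemma cov_curv_linear1 x u v w : V x -> linear (fun t => cov_curv x t u v w).
Proof.
move=> Vx a t t'; rewrite /cov_curv (cov_linear (smooth_curv u v w) Vx).
rewrite (Gl Vx u) (Gl Vx v) (Gl Vx w).
rewrite (curv_linear1 v w Vx) (curv_linear2 u w Vx) (curv_linear3 u v Vx).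
by rowring.
Qed.

Lemma cov_curv_linear3 x t u w : V x -> linear (fun v => cov_curv x t u v w).
Proof.
move=> Vx a v v'; rewrite /cov_curv.
rewrite (cov_family_linear t Vx (T := fun y v => curv y u v w)); last 2 first.
- by move=> y Vy; exact: curv_linear2.
- by move=> ?; exact: smooth_curv.
rewrite (Gr Vx t) !(curv_linear2 _ _ Vx); rowring.
Qed.

Lemma cov_curvC x t u v w : V x -> cov_curv x t u v w = - cov_curv x t v u w.
Proof.
move=> Vx.
have E : cov t (fun y : 'rV[R]_m => curv y u v w) x
    = - cov t (fun y : 'rV[R]_m => curv y v u w) x.
  rewrite -[RHS]add0r -{1}(lin0 (Gr Vx t)) -(cov_cst t 0 x) -covB//; last 2 first.
  - exact: smooth_cst.
  - exact: smooth_curv.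
  by apply: cov_ext => // y _; rewrite sub0r -curvC.
rewrite /cov_curv E (curvC x (Gam x t u)) (curvC x u (Gam x t v)) (curvC x u v).
by rowring.
Qed.

Variable B : 'rV[R]_m -> 'rV[R]_m -> 'rV[R]_m -> R.
Hypotheses (Bsym : forall x, V x -> forall u v, B x u v = B x v u)
  (Br : forall x, V x -> forall u, linear (B x u : 'rV[R]_m -> R))
  (Bs : forall u v, smooth_on V (fun x => B x u v))
  (Bcompat : forall x, V x -> forall u v w,
    'D_u (fun y : 'rV[R]_m => B y v w) x = B x (Gam x u v) w + B x v (Gam x u w)).

Lemma Bl x : V x -> forall v, linear (fun u => B x u v : R).
Proof. by move=> Vx v a u u'; rewrite !(Bsym Vx _ v) Br. Qed.

Let BDr x : V x -> forall u v w, B x u (v + w) = B x u v + B x u w.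
Proof. by move=> Vx u *; rewrite (linD (Br Vx u)). Qed.
Let BDl x : V x -> forall u v w, B x (v + w) u = B x v u + B x w u.
Proof. by move=> Vx u *; rewrite (linD (Bl Vx u)). Qed.
Let BNr x : V x -> forall u v, B x u (- v) = - B x u v.
Proof. by move=> Vx u *; rewrite (linN (Br Vx u)). Qed.
Let BNl x : V x -> forall u v, B x (- v) u = - B x v u.
Proof. by move=> Vx u *; rewrite (linN (Bl Vx u)). Qed.

Let BE x (Vx : V x) := (BDr Vx, BDl Vx, BNr Vx, BNl Vx).

Lemma derive_metric u Y Z x : V x -> smooth_on V Y -> smooth_on V Z ->
  'D_u (fun y : 'rV[R]_m => B y (Y y) (Z y)) x
  = B x (cov u Y x) (Z x) + B x (Y x) (cov u Z x).
Proof.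
move=> Vx sY sZ.
rewrite (derive_apply Vo (T := fun y v => B y v (Z y)) (Y := Y))//; last 2 first.
- by move=> y Vy; exact: Bl.
- move=> v; apply: (smooth_apply Vo (T := fun y w => B y v w)) => // y Vy.
  exact: Br.
rewrite (derive_apply Vo (T := fun y w => B y (Y x) w) (Y := Z))//; last first.
  by move=> y Vy; exact: Br.
by rewrite Bcompat// /cov !BDr// !BDl//; ring.
Qed.

(** Two derivatives of the function g(w, z) commute. *)
Lemma curv_skew x u v w z : V x ->
  B x (curv x u v w) z + B x w (curv x u v z) = 0.
Proof.
move=> Vx.
have c (a : 'rV[R]_m) : smooth_on V (fun _ : 'rV[R]_m => a)
  by exact: smooth_cst.
have E a b : 'D_a (fun y : 'rV[R]_m => 'D_b (fun y : 'rV[R]_m => B y w z) y) x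
  = B x (cov a (fun y : 'rV[R]_m => Gam y b w) x) z + B x (Gam x b w) (Gam x a z)
    + (B x (Gam x a w) (Gam x b z) + B x w (cov a (fun y : 'rV[R]_m => Gam y b z) x)).
  rewrite (derive_ext Vo a Vx (fun y Vy => Bcompat Vy b w z)).
  have s1 : smooth_on V (fun y => B y (Gam y b w) z).
    apply: (smooth_apply Vo (T := fun y v => B y v z)) => // y Vy.
    exact: Bl.
  have s2 : smooth_on V (fun y => B y w (Gam y b z)).
    apply: (smooth_apply Vo (T := fun y v => B y w v)) => // y Vy.
    exact: Br.
  rewrite (deriveD (f := fun y : 'rV[R]_m => B y (Gam y b w) z)
    (g := fun y : 'rV[R]_m => B y w (Gam y b z))); last 2 first.
  - exact: smooth_derivable s1 Vx.
  - exact: smooth_derivable s2 Vx.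
  rewrite (derive_metric a Vx (Gs b w) (c z)).
  rewrite (derive_metric a Vx (c w) (Gs b z)).
  by rewrite !cov_cst.
have := etrans (esym (E u v)) (etrans (schwarz_scalar Vo u v Vx (Bs w z)) (E v u)).
rewrite (curv_covE u v w Vx) (curv_covE u v z Vx) /cov !(BE Vx).
abstract_values B; lra.
Qed.

(** The octahedron argument: add the Bianchi identities of the faces
    (u, v, w) and (v, w, z) and subtract those of (w, z, u) and (z, u, v). *)
Lemma curv_pair x u v w z : V x -> B x (curv x u v w) z = B x (curv x w z u) v.
Proof.
move=> Vx; pose r a b c d := B x (curv x a b c) d.
have s12 a b c d : r a b c d = - r b a c d by rewrite /r curvC BNl.
have s34 a b c d : r a b c d = - r a b d c.
  by apply/eqP; rewrite -addr_eq0 /r (Bsym Vx (curv x a b d)) curv_skew.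
have bi a b c d : r a b c d + r b c a d + r c a b d = 0.
  rewrite /r -!BDl// bianchi//.
  by rewrite (lin0 (Bl Vx d)).
rewrite -/(r u v w z) -/(r w z u v).
move: (bi u v w z) (bi v w z u) (bi w z u v) (bi z u v w).
move: (s34 v w z u) (s34 w z v u) (s12 u w z v) (s34 w u z v).
move: (s34 z u v w) (s34 u v z w) (s12 v z u w) (s34 z v u w).
lra.
Qed.

Hypothesis Bnd : forall x, V x -> forall u, (forall v, B x u v = 0) -> u = 0.

Lemma metric_eq x a b : V x -> (forall w, B x a w = B x b w) -> a = b.
Proof.
move=> Vx ab; apply/eqP; rewrite -subr_eq0; apply/eqP/(Bnd Vx) => w.
by rewrite !(BE Vx) ab subrr.
Qed.

Section Killing.
Variable K : 'rV[R]_m -> 'rV[R]_m.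
Hypothesis (Ks : smooth_on V K)
  (KK : forall x, V x -> forall u v, B x (cov u K x) v + B x u (cov v K x) = 0).

Local Notation A := (fun y v : 'rV[R]_m => cov v K y).

Let cov_endoE u v x :
  cov_endo A u v x = cov u (cov v K) x - cov (Gam x u v) K x.
Proof. by []. Qed.

Lemma smooth_cov_killing v : smooth_on V (fun y => A y v).
Proof. exact: smooth_cov. Qed.

(** The derivative of the Killing equation. *)
Lemma killing_second_skew x u v w : V x ->
  B x (cov_endo A u v x) w + B x v (cov_endo A u w x) = 0.
Proof.
move=> Vx.
have c (a : 'rV[R]_m) : smooth_on V (fun _ : 'rV[R]_m => a)
  by exact: smooth_cst.
have sA a : smooth_on V (cov a K) by exact: smooth_cov_killing.
have : 'D_u (fun y : 'rV[R]_m => B y (cov v K y) w + B y v (cov w K y)) x = 0.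
  by rewrite (derive_ext Vo u Vx (fun y Vy => KK Vy v w)) derive_cst.
have s1 : smooth_on V (fun y => B y (cov v K y) w).
  by apply: (smooth_apply Vo (T := fun y v => B y v w)) => // y Vy; exact: Bl.
have s2 : smooth_on V (fun y => B y v (cov w K y)).
  by apply: (smooth_apply Vo (T := fun y w => B y v w)) => // y Vy; exact: Br.
rewrite (deriveD (f := fun y : 'rV[R]_m => B y (cov v K y) w)
    (g := fun y : 'rV[R]_m => B y v (cov w K y))); last 2 first.
- exact: smooth_derivable s1 Vx.
- exact: smooth_derivable s2 Vx.
rewrite (derive_metric u Vx (sA v) (c w)).
rewrite (derive_metric u Vx (c v) (sA w)).
move: (KK Vx v (Gam x u w)) (KK Vx (Gam x u v) w); rewrite !cov_cst /cov_endo /cov !(BE Vx).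
abstract_values B; lra.
Qed.

(** The Ricci identity applied to [K], as the connection is torsion free. *)
Lemma killing_second_alt x u v : V x ->
  cov_endo A u v x - cov_endo A v u x = curv x u v (K x).
Proof.
by move=> Vx; rewrite -(ricci u v Vx Ks) !cov_endoE (Gsym Vx v u); rowring.
Qed.

(** The trilinear form g((nabla_u A)v, w) is skew in v, w, and its alternation
    in u, v is a curvature term.  Hence, as in the Koszul formula, it is
    determined by the curvature, and the Bianchi identity and the pair symmetry
    simplify the result. *)
Lemma killing_second x u v : V x -> cov_endo A u v x = curv x u (K x) v.
Proof.
move=> Vx; apply: (metric_eq Vx) => w.
have s12 a b c : B x (cov_endo A a b x) c - B x (cov_endo A b a x) c
    = B x (curv x a b (K x)) c.
  by rewrite -(linB (Bl Vx c)) killing_second_alt.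
have s23 a b c : B x (cov_endo A a b x) c + B x (cov_endo A a c x) b = 0.
  by rewrite (Bsym Vx _ b) killing_second_skew.
have bi : B x (curv x u v (K x)) w + B x (curv x v (K x) u) w
     + B x (curv x (K x) u v) w = 0.
  by rewrite -!BDl// bianchi// (lin0 (Bl Vx w)).
have p1 : B x (curv x v w (K x)) u = B x (curv x (K x) u v) w
  by rewrite curv_pair.
have p2 : B x (curv x w u (K x)) v = B x (curv x (K x) v w) u
  by rewrite curv_pair.
have sk := curv_skew (K x) v u w Vx; rewrite (Bsym Vx u) in sk.
move: (s12 u v w) (s12 v w u) (s12 w u v) (s23 u v w) (s23 v w u) (s23 w u v).
have p3 a b : B x (curv x a (K x) b) w = - B x (curv x (K x) a b) w.
  by rewrite curvC BNl.
rewrite p1 p2 (p3 u v); move: bi sk; rewrite (p3 v u).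
by abstract_values B; lra.
Qed.

(** Differentiate nabla_v A = R(v, K) in the direction [t] and alternate in
    t, v: on the left appears a commutator of two derivatives of A, which the
    Ricci identity evaluates as [R(t, v), A]. *)
Lemma cov_curv_killing x t v w : V x ->
  cov_curv x t v (K x) w - cov_curv x v t (K x) w =
  curv x t v (cov w K x) - cov (curv x t v w) K x
  - curv x v (cov t K x) w + curv x t (cov v K x) w.
Proof.
move=> Vx.
have c (a : 'rV[R]_m) : smooth_on V (fun _ : 'rV[R]_m => a)
  by exact: smooth_cst.
have sA a : smooth_on V (cov a K) by exact: smooth_cov_killing.
have Al y : V y -> linear (A y) by move=> Vy; exact: (cov_linear Ks Vy).
have E a b : cov_curv x a b (K x) w = cov a (cov b (cov w K)) x
    - cov_endo A a (Gam x b w) x - cov (cov a (fun y : 'rV[R]_m => Gam y b w) x) K x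
    - curv x b (cov a K x) w
    - cov_endo A b (Gam x a w) x - cov_endo A (Gam x a b) w x.
  have := cov_curv_apply a Vx (c b) Ks (c w).
  rewrite (cov_ext a Vx (fun y Vy => esym (killing_second b w Vy))).
  rewrite (covB a (Y := cov b (cov w K))
    (Z := fun y : 'rV[R]_m => cov (Gam y b w) K y))//; last 2 first.
  - exact: smooth_cov.
  - by apply: (smooth_apply Vo (T := A)).
  rewrite (cov_apply (T := A))//.
  rewrite !cov_cst -killing_second// -killing_second//.
  by rowlra.
rewrite (E t v) (E v t) (curv_covE t v w Vx).
rewrite (linB (cov_linear Ks Vx)) -(ricci t v Vx (sA w)) (Gsym Vx v t).
by rowring.
Qed.

End Killing.

(** In this section [z ord0] stands for xi_0 and the other [z i] for
    xi_1, ..., xi_n, so that statements need not distinguish the two kinds. *)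
Section Frame.
Context {k : nat}.
Variable z : 'I_k.+1 -> 'rV[R]_m -> 'rV[R]_m.
Hypotheses (zs : forall i, smooth_on V (z i))
  (zK : forall i x, V x -> forall u v,
     B x (cov u (z i) x) v + B x u (cov v (z i) x) = 0)
  (z_span : forall x, V x -> forall v, B x (z ord0 x) v = 0 <->
     exists a : 'I_k.+1 -> R, v = \sum_i a i *: z i x)
  (z_neq0 : forall x, V x -> z ord0 x != 0)
  (z_bracket0 : forall i x, V x -> bracket (z ord0) (z i) x = 0)
  (z_bracket : forall i j x, V x ->
     exists a : R, bracket (z i) (z j) x = a *: z ord0 x).

Lemma frame_perp i x : V x -> B x (z ord0 x) (z i x) = 0.
Proof.
move=> Vx; apply/(z_span Vx); exists (fun j => (j == i)%:R).
rewrite (bigD1 i)//= eqxx scale1r big1 ?addr0// => j /negPf->.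
by rewrite scale0r.
Qed.

(** The span hypothesis, in the form in which it is used: a linear map that
    vanishes on the frame vanishes on the orthogonal of [z ord0]. *)
Lemma perp_frame_eq0 (W : lmodType R) (T : 'rV[R]_m -> W) x v : V x ->
  linear T -> (forall i, T (z i x) = 0) -> B x (z ord0 x) v = 0 -> T v = 0.
Proof.
move=> Vx Tl T0 /(z_span Vx)[a ->]; rewrite (lin_sum Tl) big1// => i _.
by rewrite (linZ Tl) T0 scaler0.
Qed.

Lemma transversal x : V x -> exists t, B x (z ord0 x) t = 1.
Proof.
move=> Vx; apply: contrapT => noT.
have /eqP : z ord0 x = 0.
  apply: (Bnd Vx) => v; apply: contrapT => /eqP v0; apply: noT.
  exists ((B x (z ord0 x) v)^-1 *: v).
  by rewrite (linZ (Br Vx _)) /= [LHS]mulVf.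
by rewrite (negPf (z_neq0 Vx)).
Qed.

Lemma transversal_perp x t u : V x -> B x (z ord0 x) t = 1 ->
  B x (z ord0 x) (u - B x (z ord0 x) u *: t) = 0.
Proof.
move=> Vx t1; rewrite (linB (Br Vx _)) (linZ (Br Vx _)) t1.
by rewrite [_ *: _]mulr1 subrr.
Qed.

(** A vector orthogonal to the frame is orthogonal to the hyperplane that the
    frame spans, and the metric is nondegenerate.  A vector [t] transversal to
    the hyperplane gives the coefficient. *)
Lemma perp_line x u : V x -> (forall i, B x u (z i x) = 0) ->
  exists f : R, u = f *: z ord0 x.
Proof.
move=> Vx u0; have [t t1] := transversal Vx.
exists (B x u t); apply: (metric_eq Vx) => w.
have := perp_frame_eq0 Vx (Br Vx u) u0 (transversal_perp w Vx t1).
rewrite (linB (Br Vx _)) (linZ (Br Vx _)) (linZ (Bl Vx w)) => /eqP.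
by rewrite subr_eq0 => /eqP ->; rewrite [LHS]mulrC.
Qed.

(** The form g(T v, w) is alternating and has a hyperplane in its kernel, so it
    is an alternating form on a line. *)
Lemma skew_frame_eq0 x (T : 'rV[R]_m -> 'rV[R]_m) u : V x -> linear T ->
  (forall v w, B x (T v) w + B x v (T w) = 0) -> (forall i, T (z i x) = 0) ->
  T u = 0.
Proof.
move=> Vx Tl Ts T0; have [t t1] := transversal Vx.
(* T factors through the quotient by the hyperplane. *)
have Tt v : T v = B x (z ord0 x) v *: T t.
  apply/eqP; rewrite -subr_eq0 -(linZ Tl) -(linB Tl).
  by rewrite (perp_frame_eq0 Vx Tl T0)//; exact: transversal_perp.
suff Tt0 : T t = 0 by rewrite Tt Tt0 scaler0.
apply: (Bnd Vx) => w; have := Ts t w; have := Ts t t.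
rewrite (Tt w) (linZ (Br Vx t)) (Bsym Vx t (T t)).
rewrite -mulr2n => /eqP; rewrite mulrn_eq0 /= => /eqP ->.
by rewrite scaler0 addr0.
Qed.

Let torsion x i j : V x ->
  cov (z i x) (z j) x - cov (z j x) (z i) x = bracket (z i) (z j) x.
Proof. by move=> Vx; rewrite /cov /bracket (Gsym Vx (z i x)); rowring. Qed.

(** A trilinear symbol that is symmetric in the first two indices and skew in
    the outer two is zero. *)
Lemma cov_frame_perp x i j l : V x ->
  B x (cov (z i x) (z j) x) (z l x) = 0.
Proof.
move=> Vx; pose a i j l := B x (cov (z i x) (z j) x) (z l x).
have sym p q r : a p q r = a q p r.
  apply/eqP; rewrite -subr_eq0 -(linB (Bl Vx _)) torsion//.
  have [c ->] := z_bracket p q Vx.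
  by rewrite (linZ (Bl Vx _)) (frame_perp r Vx) scaler0.
have skew p q r : a p q r + a r q p = 0.
  by have := zK q Vx (z p x) (z r x); rewrite (Bsym Vx (z p x)).
rewrite -/(a i j l).
move: (sym i j l) (skew j i l) (sym l i j) (skew i l j) (sym j l i) (skew l j i).
lra.
Qed.

Lemma cov_frame_line x i j : V x ->
  exists f : R, cov (z i x) (z j) x = f *: z ord0 x.
Proof. by move=> Vx; apply: perp_line => // l; exact: cov_frame_perp. Qed.

(** With A_i the derivative of [z i], [z_bracket0] says A_i z_0 = A_0 z_i.  As
    A_0 and A_i are skew, the derivative of g(z_0, z_i) = 0 along u then
    amounts to 2 g(A_0 z_i, u) = 0. *)
Lemma cov_ord0_frame x i : V x -> cov (z i x) (z ord0) x = 0.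
Proof.
move=> Vx; apply: (Bnd Vx) => u.
have t0 : cov (z ord0 x) (z i) x = cov (z i x) (z ord0) x.
  by apply/eqP; rewrite -subr_eq0 torsion// z_bracket0.
have : 'D_u (fun y : 'rV[R]_m => B y (z ord0 y) (z i y)) x = 0.
  by rewrite (derive_ext Vo u Vx (frame_perp i)) derive_cst.
rewrite (derive_metric u Vx (zs _) (zs _)).
have := zK ord0 Vx u (z i x); have := zK i Vx (z ord0 x) u.
rewrite t0 (Bsym Vx u); abstract_values B; lra.
Qed.

Lemma cov_frame_ord0 x i : V x -> cov (z ord0 x) (z i) x = 0.
Proof.
by move=> Vx; apply/eqP; rewrite -(cov_ord0_frame i Vx) -subr_eq0 torsion// z_bracket0.
Qed.

Lemma cov_perp x u i : V x -> B x (z ord0 x) (cov u (z i) x) = 0.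
Proof.
move=> Vx; have := zK i Vx (z ord0 x) u.
by rewrite cov_frame_ord0// (lin0 (Bl Vx _)) add0r.
Qed.

Lemma cov_ord0 x u : V x -> cov u (z ord0) x = 0.
Proof.
move=> Vx; apply: (skew_frame_eq0 (T := fun u => cov u (z ord0) x) u Vx).
- exact: cov_linear.
- exact: zK.
- by move=> i; exact: cov_ord0_frame.
Qed.

Lemma curv_ord0_3 x u v : V x -> curv x u v (z ord0 x) = 0.
Proof.
move=> Vx; rewrite -ricci//.
have E a b : cov a (cov b (z ord0)) x = 0.
  rewrite (cov_ext a Vx (fun y Vy => cov_ord0 b Vy)) cov_cst.
  exact: (lin0 (Gr Vx a)).
by rewrite (E u v) (E v u) subrr.
Qed.

(** By pair symmetry, from the vanishing on a parallel field. *)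
Lemma curv_ord0_1 x u v : V x -> curv x (z ord0 x) u v = 0.
Proof.
move=> Vx; apply: (Bnd Vx) => w.
by rewrite curv_pair// curv_ord0_3// (lin0 (Bl Vx _)).
Qed.

Lemma curv_ord0_2 x u v : V x -> curv x u (z ord0 x) v = 0.
Proof. by move=> Vx; rewrite curvC curv_ord0_1// oppr0. Qed.

(** Derivative along [u] of g(nabla_{z_a} z_c, z_b) = 0.  By [killing_second]
    the second derivative of z_c is R(u, z_c) z_a; the two remaining terms pair
    a multiple of z_0 with the derivative of a frame field, which is orthogonal
    to z_0. *)
Lemma curv_frame_perp x u c a b : V x ->
  B x (curv x u (z c x) (z a x)) (z b x) = 0.
Proof.
move=> Vx; pose A := fun y v : 'rV[R]_m => cov v (z c) y.
have Al y : V y -> linear (A y) by exact: cov_linear.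
have As v : smooth_on V (fun y => A y v) by exact: smooth_cov.
have sY : smooth_on V (fun y => A y (z a y)) by exact: (smooth_apply Vo Al As).
have : 'D_u (fun y : 'rV[R]_m => B y (A y (z a y)) (z b y)) x = 0.
  by rewrite (derive_ext Vo u Vx (fun y Vy => cov_frame_perp a c b Vy)) derive_cst.
rewrite (derive_metric u Vx sY (zs b)) (cov_apply u Vx Al As (zs a)).
rewrite (killing_second (zs c) (zK c) u (z a x) Vx) (linD (Bl Vx _)) /A.
have [f ->] := cov_frame_line a c Vx.
rewrite (linZ (Bl Vx _)) cov_perp// scaler0 addr0.
have := zK c Vx (cov u (z a) x) (z b x).
have [f' ->] := cov_frame_line b c Vx.
rewrite (linZ (Br Vx _)) (Bsym Vx _ (z ord0 x)) cov_perp// scaler0 addr0 => ->.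
by rewrite addr0.
Qed.

(** The pair symmetry exchanges [curv_frame_perp] for the vanishing of
    R(z_a, z_b) z_c. *)
Lemma curv_frame x a b u : V x -> curv x (z a x) (z b x) u = 0.
Proof.
move=> Vx; apply: (skew_frame_eq0 u Vx).
- exact: curv_linear3.
- by move=> v w; exact: curv_skew.
move=> c; apply: (Bnd Vx) => w.
by rewrite curv_pair// curvC (linN (Bl Vx _)) curv_frame_perp// oppr0.
Qed.

Lemma curv_perp x u v w : V x -> B x (z ord0 x) u = 0 ->
  B x (z ord0 x) v = 0 -> curv x u v w = 0.
Proof.
move=> Vx u0 v0.
apply: (perp_frame_eq0 (T := fun u => curv x u v w) Vx _ _ u0).
  exact: curv_linear1.
move=> a; apply: (perp_frame_eq0 (T := fun v => curv x (z a x) v w) Vx _ _ v0).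
  exact: curv_linear2.
by move=> b; exact: curv_frame.
Qed.

(** The identity [cov_curv_killing] for K = z_a and t = z_c.  Its commutator is
    skew and kills the frame; its other terms vanish because nabla_{z_c} z_a is
    a multiple of z_0, or by [curv_perp]. *)
Lemma cov_curv_frame x c v a w : V x ->
  cov_curv x (z c x) v (z a x) w = 0.
Proof.
move=> Vx.
(* The commutator of R(z_c, v) and A_a, applied to w. *)
have T0 : curv x (z c x) v (cov w (z a) x)
    - cov (curv x (z c x) v w) (z a) x = 0.
  apply: (skew_frame_eq0 (T := fun w => curv x (z c x) v (cov w (z a) x)
    - cov (curv x (z c x) v w) (z a) x) w Vx).
  - move=> l p q; rewrite (cov_linear (zs a) Vx) (curv_linear3 _ _ Vx).
    rewrite (curv_linear3 _ _ Vx) (cov_linear (zs a) Vx); rowring.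
  - move=> p q; rewrite (linB (Bl Vx _)) (linB (Br Vx _)).
    have := curv_skew (z c x) v (cov p (z a) x) q Vx.
    have := curv_skew (z c x) v (cov q (z a) x) p Vx.
    have := zK a Vx (curv x (z c x) v p) q.
    have := zK a Vx (curv x (z c x) v q) p.
    rewrite (Bsym Vx p (cov (curv x (z c x) v q) (z a) x)).
    rewrite (Bsym Vx p (curv x (z c x) v (cov q (z a) x))).
    rewrite (Bsym Vx (cov p (z a) x) (curv x (z c x) v q)).
    rewrite (Bsym Vx (cov q (z a) x) (curv x (z c x) v p)).
    by abstract_values B; lra.
  - move=> b; have [f ->] := cov_frame_line b a Vx.
    rewrite (linZ (curv_linear3 _ _ Vx)) curv_ord0_3// scaler0 sub0r.
    have [f' ->] : exists f', curv x (z c x) v (z b x) = f' *: z ord0 x.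
      apply: perp_line => // d.
      by rewrite curvC (linN (Bl Vx _)) curv_frame_perp// oppr0.
    by rewrite (linZ (cov_linear (zs a) Vx)) cov_frame_ord0// scaler0 oppr0.
(* R(z_c, z_a) is identically zero: differentiate it along v. *)
have D0 : cov_curv x v (z c x) (z a x) w = 0.
  have sw : smooth_on V (fun _ : 'rV[R]_m => w) by exact: smooth_cst.
  have := cov_curv_apply v Vx (zs c) (zs a) sw.
  rewrite (cov_ext v Vx (fun y Vy => curv_frame c a w Vy)).
  rewrite cov_cst (lin0 (Gr Vx v)) curv_frame// addr0.
  rewrite (curv_perp (u := cov v (z c) x))//; last 2 first.
  - exact: cov_perp.
  - exact: frame_perp.
  rewrite (curv_perp (v := cov v (z a) x))//; last 2 first.
  - exact: frame_perp.
  - exact: cov_perp.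
  by rewrite !addr0.
have := cov_curv_killing (zs a) (zK a) (z c x) v w Vx.
rewrite D0 subr0 T0 sub0r => ->.
have [f ->] := cov_frame_line c a Vx.
rewrite (linZ (curv_linear2 _ _ Vx)) curv_ord0_2// scaler0 oppr0 add0r.
by apply: curv_perp => //; [exact: frame_perp|exact: cov_perp].
Qed.

(** By [cov_curv_frame] the second argument of R may be taken transversal, by
    skewness so may the first, and R(s, s) = 0. *)
Lemma cov_curv_perp x t u v w : V x -> B x (z ord0 x) t = 0 ->
  cov_curv x t u v w = 0.
Proof.
move=> Vx; apply: (perp_frame_eq0 (T := fun t => cov_curv x t u v w) Vx).
  exact: cov_curv_linear1.
move=> c; have [s s1] := transversal Vx.
(* Replace q by its component along the transversal vector s. *)
have red p q : cov_curv x (z c x) p q w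
    = B x (z ord0 x) q *: cov_curv x (z c x) p s w.
  have l3 := cov_curv_linear3 (z c x) p w Vx.
  apply/eqP; rewrite -subr_eq0 -(linZ l3) -(linB l3).
  apply/eqP; apply: (perp_frame_eq0 Vx l3) => [a|]; first exact: cov_curv_frame.
  exact: transversal_perp.
have ss : cov_curv x (z c x) s s w = 0.
  apply/eqP; have /eqP := cov_curvC (z c x) s s w Vx.
  by rewrite -addr_eq0 -mulr2n -scaler_nat scaler_eq0 pnatr_eq0.
by rewrite red cov_curvC// red ss scaler0 oppr0 scaler0.
Qed.

End Frame.

End Curvature.

(** * Reading the hypotheses in a chart *)

Section Form.
Context {R : realType} {m : nat} (G : 'M[R]_m).

Lemma form_linearr u : linear (Defs.form G u : 'rV[R]_m -> R).
Proof.
move=> a v w; rewrite /Defs.form linearD linearZ /= mulmxDr -scalemxAr.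
by rewrite !mxE.
Qed.

Lemma formC u v : G^T = G -> Defs.form G u v = Defs.form G v u.
Proof.
move=> Gs; rewrite /Defs.form -[in LHS](trmxK (u *m G *m v^T)) [in LHS]mxE.
by rewrite !trmx_mul trmxK Gs mulmxA.
Qed.

Lemma form_nondegenerate u : G \in unitmx ->
  (forall v, Defs.form G u v = 0) -> u = 0.
Proof.
move=> Gu u0; apply: (can_inj (mulmxK Gu)); rewrite mul0mx.
apply/rowP => j; have := u0 (delta_mx 0 j).
by rewrite /Defs.form trmx_delta -colE !mxE.
Qed.

Lemma formE u v : Defs.form G u v = \sum_j v 0 j *: (\sum_i u 0 i *: G i j).
Proof.
rewrite /Defs.form mxE; apply: eq_bigr => j _.
by rewrite !mxE mulrC.
Qed.

End Form.

(** The set [V] is the domain of the local vector fields on which the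
    conclusions are tested; constant fields on [V] turn the hypotheses on
    fields into pointwise identities. *)
Section Chart.
Context {R : realType} {n : nat} {M : manifold R n.+2}.
Context {g : metric M} {D : connection M} (hD : levi_civita g D).
Context (c : atlas M) (V : set 'rV[R]_n.+2) (Vo : open V) (Vc : V `<=` cod c).

Local Notation Gam := (christoffel D c).
Local Notation B := (fun x => Defs.form (gram g c x)).

Lemma local_cst (u : 'rV[R]_n.+2) : local_vfield c V (fun=> u).
Proof. by split=> //; exact: smooth_cst. Qed.

Lemma smooth_form u v : smooth_on V (fun x => B x u v).
Proof.
have sG : smooth_on V (gram g c) by apply: smooth_sub (@gram_smooth _ _ _ g c).
apply: (smooth_ext Vo (fun x _ => esym (formE (gram g c x) u v))).
apply: smooth_sum => // j; apply: smoothZ => //; first exact: smooth_cst.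
apply: smooth_sum => // i; apply: smoothZ => //; first exact: smooth_cst.
exact: smooth_coord.
Qed.

Lemma christoffel_sym x : V x -> forall u v, Gam x u v = Gam x v u.
Proof.
move=> Vx u v; have := hD.1 c V _ _ (local_cst u) (local_cst v) x Vx.
rewrite /nabla /bracket !derive_cst subrr !add0r => /eqP.
by rewrite subr_eq0 => /eqP.
Qed.

Lemma derive_form x : V x -> forall u v w,
  'D_u (fun y : 'rV[R]_n.+2 => B y v w) x = B x (Gam x u v) w + B x v (Gam x u w).
Proof.
move=> Vx u v w.
have := hD.2 c V _ _ _ (local_cst u) (local_cst v) (local_cst w) x Vx.
by rewrite /gprod /nabla !derive_cst !add0r.
Qed.

Lemma bracket_cst (Y : 'rV[R]_n.+2 -> 'rV[R]_n.+2) u x :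
  bracket Y (fun=> u) x = - 'D_u Y x.
Proof. by rewrite /bracket derive_cst add0r. Qed.

(** The Killing equation for constant fields, with the derivative of the metric
    computed by compatibility with the connection. *)
Lemma killing_skew K x : killing g K -> V x -> forall u v,
  B x (cov Gam u (K c) x) v + B x u (cov Gam v (K c) x) = 0.
Proof.
move=> hK Vx u v; have := etrans (esym (derive_form Vx (K c x) u v))
  (hK c V _ _ (local_cst u) (local_cst v) x Vx).
rewrite /gprod !bracket_cst /cov.
rewrite (christoffel_sym Vx (K c x)) (christoffel_sym Vx (K c x)).
have Br := form_linearr (gram g c x).
have Bs a b : Defs.form (gram g c x) a b = Defs.form (gram g c x) b a.
  by apply: formC; apply: gram_sym; exact: Vc.
rewrite (Bs (- _)) (linN (Br _)) (linN (Br _)) (Bs v).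
rewrite (Bs (_ + _)) !(linD (Br _)) (Bs v) (Bs v).
lra.
Qed.

Let Gl x : V x -> forall v, linear (fun u => Gam x u v).
Proof. by move=> Vx v; apply: christoffel_linearl; exact: Vc. Qed.

Let Gr x : V x -> forall u, linear (Gam x u).
Proof. by move=> Vx u; apply: christoffel_linearr; exact: Vc. Qed.

Let Gs u v : smooth_on V (fun x => Gam x u v).
Proof. by apply: (smooth_sub Vc); exact: christoffel_smooth. Qed.

Lemma riem_curv X Y Z x : V x -> smooth_on V X -> smooth_on V Y ->
  smooth_on V Z -> riem D c X Y Z x = curv Gam x (X x) (Y x) (Z x).
Proof. exact: (curv_fields Vo Gl Gr Gs christoffel_sym). Qed.

Lemma nabla_riem_cov_curv X Y Z W x : V x -> smooth_on V X -> smooth_on V Y ->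
  smooth_on V Z -> smooth_on V W ->
  nabla_riem D c X Y Z W x = cov_curv Gam x (X x) (Y x) (Z x) (W x).
Proof.
move=> Vx sX sY sZ sW.
have sN P Q : smooth_on V P -> smooth_on V Q -> smooth_on V (nabla D c P Q).
  exact: (smooth_cov_field Vo Gl Gr Gs).
rewrite /nabla_riem (riem_curv Vx (sN _ _ sX sY) sZ sW).
rewrite (riem_curv Vx sY (sN _ _ sX sZ) sW) (riem_curv Vx sY sZ (sN _ _ sX sW)).
have -> : nabla D c X (riem D c Y Z W) x = cov Gam (X x)
    (fun y : 'rV[R]_n.+2 => curv Gam y (Y y) (Z y) (W y)) x.
  by apply: (cov_ext Gam Vo) => // y Vy; exact: riem_curv.
rewrite (cov_curv_apply Vo Gl Gr Gs (X x) Vx sY sZ sW) /nabla /cov; rowring.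
Qed.

Section Frame.
Context {xi0 : vfield M} {xi : 'I_n -> vfield M}.
Hypotheses (hK0 : killing g xi0) (hK : forall i, killing g (xi i))
  (hspan : span_perp g xi0 xi)
  (hbr0 : forall i c x, cod c x -> bracket (xi0 c) (xi i c) x = 0)
  (hbr : forall i j c x, cod c x ->
     exists a : R, bracket (xi i c) (xi j c) x = a *: xi0 c x).

Definition frame (i : 'I_n.+1) : vfield M :=
  if unlift ord0 i is Some j then xi j else xi0.

Lemma frame0 : frame ord0 = xi0.
Proof. by rewrite /frame unlift_none. Qed.

Lemma frameS j : frame (lift ord0 j) = xi j.
Proof. by rewrite /frame liftK. Qed.

(** If xi_0 vanished at a point, its orthogonal would be the whole space of
    dimension n + 2, spanned by the n vectors xi_i. *)
Lemma span_perp_neq0 x : V x -> xi0 c x != 0.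
Proof.
move=> Vx; apply/eqP => x0.
pose P := \matrix_(i < n) xi i c x.
have : (1%:M <= P)%MS.
  apply/row_subP => i; have := (hspan (Vc Vx) (row i 1%:M)).1.
  have -> : Defs.form (gram g c x) (xi0 c x) (row i 1%:M) = 0.
    by rewrite /Defs.form x0 !mul0mx mxE.
  move=> /(_ erefl)[a0 [a ->]].
  rewrite x0 scaler0 add0r; apply: summx_sub => k _; apply: scalemx_sub.
  by rewrite -(rowK (fun i => xi i c x)) row_sub.
move/mxrankS; rewrite mxrank1 => /leq_trans/(_ (rank_leq_row P)).
by rewrite ltnNge leqnSn.
Qed.

Let frame_span x : V x -> forall v, B x (frame ord0 c x) v = 0 <->
  exists a : 'I_n.+1 -> R, v = \sum_i a i *: frame i c x.
Proof.
move=> Vx v; rewrite frame0; apply: (iff_trans (hspan (Vc Vx) v)); split.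
- move=> [a0 [a ->]].
  exists (fun i => if unlift ord0 i is Some j then a j else a0).
  rewrite big_ord_recl /= unlift_none frame0; congr (_ + _).
  by apply: eq_bigr => j _; rewrite liftK frameS.
- move=> [a ->]; exists (a ord0), (fun j => a (lift ord0 j)).
  rewrite big_ord_recl frame0; congr (_ + _).
  by apply: eq_bigr => j _; rewrite frameS.
Qed.

Let frame_killing i : killing g (frame i).
Proof. by rewrite /frame; case: unlift. Qed.

Let frame_neq0 x : V x -> frame ord0 c x != 0.
Proof. by rewrite frame0; exact: span_perp_neq0. Qed.

Let frame_bracket0 i x : V x -> bracket (frame ord0 c) (frame i c) x = 0.
Proof.
move=> Vx; rewrite frame0 /frame; case: unlift => [j|].
  by apply: hbr0; exact: Vc.
by rewrite /bracket subrr.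
Qed.

Let frame_bracket i j x : V x -> exists a : R,
  bracket (frame i c) (frame j c) x = a *: frame ord0 c x.
Proof.
move=> Vx; rewrite frame0 /frame.
case: (unlift ord0 i) => [i'|]; case: (unlift ord0 j) => [j'|].
- by apply: hbr; exact: Vc.
- exists 0; rewrite scale0r /bracket -opprB -/(bracket (xi0 c) (xi i' c) x).
  by rewrite hbr0 ?oppr0//; exact: Vc.
- by exists 0; rewrite scale0r hbr0//; exact: Vc.
- by exists 0; rewrite scale0r /bracket subrr.
Qed.

Let frame_smooth i : smooth_on V (frame i c).
Proof. by apply: (smooth_sub Vc); exact: vcomp_smooth. Qed.

Let Bsym x : V x -> forall u v, B x u v = B x v u.
Proof. by move=> Vx u v; apply: formC; apply: gram_sym; exact: Vc. Qed.

Let Br x : V x -> forall u, linear (B x u : 'rV[R]_n.+2 -> R).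
Proof. by move=> _ u; exact: form_linearr. Qed.

Let Bnd x : V x -> forall u, (forall v, B x u v = 0) -> u = 0.
Proof.
move=> Vx u; apply: form_nondegenerate; apply: gram_nondegenerate; exact: Vc.
Qed.

Let frame_skew i x : V x -> forall u v,
  B x (cov Gam u (frame i c) x) v + B x u (cov Gam v (frame i c) x) = 0.
Proof. by move=> Vx u v; exact: (killing_skew (frame_killing i) Vx u v). Qed.

Lemma frame_parallel x u : V x -> cov Gam u (xi0 c) x = 0.
Proof.
rewrite -frame0; exact: (cov_ord0 Vo Gl christoffel_sym Bsym Br smooth_form
  derive_form Bnd frame_smooth frame_skew frame_span frame_neq0 frame_bracket0).
Qed.

Lemma frame_curv x u v w : V x -> B x (xi0 c x) u = 0 -> B x (xi0 c x) v = 0 ->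
  curv Gam x u v w = 0.
Proof.
rewrite -frame0; exact: (curv_perp Vo Gl Gr Gs christoffel_sym Bsym Br
  smooth_form derive_form Bnd frame_smooth frame_skew frame_span frame_neq0
  frame_bracket0 frame_bracket).
Qed.

Lemma frame_cov_curv x t u v w : V x -> B x (xi0 c x) t = 0 ->
  cov_curv Gam x t u v w = 0.
Proof.
rewrite -frame0; exact: (cov_curv_perp Vo Gl Gr Gs christoffel_sym Bsym Br
  smooth_form derive_form Bnd frame_smooth frame_skew frame_span frame_neq0
  frame_bracket0 frame_bracket).
Qed.

End Frame.

End Chart.

Theorem proposition3p1 (R : realType) (n : nat) (M : manifold R n.+2)
  (g : metric M) (D : connection M) (hD : levi_civita g D)
  (xi0 : vfield M) (xi : 'I_n -> vfield M)
  (hK0 : killing g xi0) (hK : forall i, killing g (xi i))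
  (hspan : span_perp g xi0 xi)
  (hbr0 : forall i c x, cod c x -> bracket (xi0 c) (xi i c) x = 0)
  (hbr : forall i j c x, cod c x ->
     exists a : R, bracket (xi i c) (xi j c) x = a *: xi0 c x) :
  [/\ parallel D xi0, riem_perp_eq0 g D xi0, nabla_riem_perp_eq0 g D xi0 &
      lorentzian g -> ~ flat D -> plane_wave g].
Proof.
have par : parallel D xi0.
  move=> c V X [Vo Vc _] x Vx.
  exact: (frame_parallel hD Vo Vc hK0 hK hspan hbr0 (X x) Vx).
have curv0 : riem_perp_eq0 g D xi0.
  move=> c V X Y Z [Vo Vc sX] [_ _ sY] [_ _ sZ] Xp Yp x Vx.
  rewrite (riem_curv hD Vo Vc Vx sX sY sZ).
  by apply: (frame_curv hD Vo Vc hK0 hK hspan hbr0 hbr) => //; [exact: Xp|exact: Yp].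
have cov_curv0 : nabla_riem_perp_eq0 g D xi0.
  move=> c V X Y Z W [Vo Vc sX] [_ _ sY] [_ _ sZ] [_ _ sW] Xp x Vx.
  rewrite (nabla_riem_cov_curv hD Vo Vc Vx sX sY sZ sW).
  by apply: (frame_cov_curv hD Vo Vc hK0 hK hspan hbr0 hbr) => //; exact: Xp.
split=> // Lg nflat; split=> //; exists D; split=> //; exists xi0; split=> //.
move=> c x cx; apply: (hspan c x cx (xi0 c x)).2; exists 1, (fun=> 0).
by rewrite scale1r big1 ?addr0// => i _; rewrite scale0r.
Qed.
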